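(* Let $1\le k\le n$, let $r$ be a real symmetric $n\times n$ matrix with eigenvalues $r_1,\dots,r_n$, let $x\in\mathbb R^n$ and $r_{00}\in\mathbb R$. Then the degree-$(k+1)$ polynomial $$p_{k+1}(t)=(r_{00}+t)\,\sigma_k(r+tI)-x\,T_{k-1}(r+tI)\,x^T$$ has only real roots. Moreover, if $\alpha_1\le\cdots\le\alpha_{k+1}$ are its roots and $\beta_1\le\cdots\le\beta_k$ are the (real) roots of $\sigma_k(r+tI)$, then they interlace: $\alpha_1\le\beta_1\le\alpha_2\le\beta_2\le\cdots\le\beta_k\le\alpha_{k+1}$. Furthermore $\alpha_i\in[\min_{1\le j\le n}(-r_j),\ \max_{1\le j\le n}(-r_j)]$ for $2\le i\le k-1$.
   Context: For a real symmetric $n\times n$ matrix $s$, $\sigma_j(s)$ denotes the $j$-th elementary symmetric function of its eigenvalues ($\sigma_0=1$) and $T_j(s)=\sum_{i=0}^{j}(-1)^i\sigma_{j-i}(s)s^i$ is the Newton transformation. *)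

(* Defs.v *)
From HB Require Import structures.
From mathcomp Require Import all_boot all_order all_algebra.
Set Implicit Arguments. Unset Strict Implicit. Unset Printing Implicit Defensive.
Import Order.TTheory GRing.Theory Num.Theory.
Local Open Scope ring_scope.

(* sigma j s : j-th elementary symmetric function of the eigenvalues of the
   square matrix s (counted with multiplicity, i.e. of the roots of its
   characteristic polynomial), given by Vieta: (-1)^j times the coefficient
   of X^(n-j) in char_poly s; sigma 0 = 1, and sigma j = 0 for j > n. *)
Definition sigma (R : comNzRingType) (n : nat) (j : nat) (s : 'M[R]_n) : R :=
  if (j <= n)%N then (-1) ^+ j * (char_poly s)`_(n - j) else 0.

Definition newtonT (R : comNzRingType) (n : nat) (j : nat) (s : 'M[R]_n)
  : 'M[R]_n :=
  \sum_(i < j.+1) ((-1) ^+ i * sigma (j - i) s) *: s ^+ i.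

Definition shiftX (R : comNzRingType) (n : nat) (r : 'M[R]_n)
  : 'M[{poly R}]_n :=
  map_mx polyC r + 'X%:M.

Definition pk1 (R : comNzRingType) (n k : nat) (r00 : R) (r : 'M[R]_n)
  (x : 'rV[R]_n) : {poly R} :=
  (r00%:P + 'X) * sigma k (shiftX r)
  - (map_mx polyC x *m newtonT k.-1 (shiftX r) *m (map_mx polyC x)^T) 0 0.

(* Main.v *)
(* With [q = det (t + r)], [g = x adj (t + r) x^T] and [m = n - k], Taylor expansion
   of [det] and [adj] of [z - (t + r)] in [z] gives [sigma k (r + t) = q^`N(m)] and
   [x T_(k-1) (r + t) x^T = g^`N(m)].  The pencil [q + w g = det (t + r + w x^T x)]
   has no zero with [Im t > 0] when [Im w >= 0]; by Gauss-Lucas neither has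
   [Q + w G], where [Q = q^`N(m)] and [G = g^`N(m)].  Hence [Im (G / Q) <= 0], and
   [p / Q = r00 + t - G / Q] maps the upper half-plane to itself, so that [p] and
   [Q] are real-rooted.  They interlace: after cancelling common roots, the local
   behaviour at a root of [Q] shows that it is simple and fixes the sign of [p]
   there; a parity count then locates the roots of [p] between those of [Q].
   Gauss-Lucas on vertical half-planes bounds the roots of [Q]. *)
Require Import Defs.
From HB Require Import structures.
From mathcomp Require Import all_boot all_order all_algebra.
From mathcomp Require Import polyrcf complex ring lra zify.
Set Implicit Arguments. Unset Strict Implicit. Unset Printing Implicit Defensive.
Import Order.TTheory GRing.Theory Num.Theory.
Local Open Scope ring_scope.

(* [Num.Theory] shadows these names by the projections of [numClosedFieldType]. *)
Local Notation Re := complex.Re.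
Local Notation Im := complex.Im.

(** * Polynomials without zeros in a half-plane *)

Section HalfPlane.
Variable R : rcfType.
Local Notation C := R[i].
Local Notation toC := (real_complex R).
Implicit Types (z w : C) (a : R).

Lemma ImcD z w : Im (z + w) = Im z + Im w. Proof. by case: z; case: w. Qed.
Lemma ImcN z : Im (- z) = - Im z. Proof. by case: z. Qed.
Lemma Imc_realM a z : Im (toC a * z) = a * Im z.
Proof. by case: z => u v /=; rewrite mul0r addr0. Qed.
Lemma Imc_Mreal a z : Im (z * toC a) = Im z * a.
Proof. by rewrite mulrC Imc_realM mulrC. Qed.
Lemma ImcJ z : Im z^*%C = - Im z. Proof. by case: z. Qed.
Lemma Imc_sum (I : Type) (s : seq I) (P : pred I) (f : I -> C) :
  Im (\sum_(i <- s | P i) f i) = \sum_(i <- s | P i) Im (f i).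
Proof. exact: (big_morph _ ImcD). Qed.

(** The squared modulus is valued in [R], so that signs are compared in the real field. *)
Definition sqnormc z : R := Re z ^+ 2 + Im z ^+ 2.

Lemma mulz_conj z : z * z^*%C = toC (sqnormc z).
Proof.
by case: z => a b; apply/eqP; rewrite eq_complex /sqnormc /=; apply/andP; split;
  apply/eqP; ring.
Qed.

Lemma sqnormc_ge0 z : 0 <= sqnormc z.
Proof. by rewrite addr_ge0 ?sqr_ge0. Qed.

Lemma sqnormc_eq0 z : (sqnormc z == 0) = (z == 0).
Proof. by rewrite paddr_eq0 ?sqr_ge0 // !sqrf_eq0 eq_complex. Qed.

Lemma sqnormc_gt0 z : (0 < sqnormc z) = (z != 0).
Proof. by rewrite lt0r sqnormc_ge0 sqnormc_eq0 andbT. Qed.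

Lemma Imc_neq0 z : Im z != 0 -> z != 0.
Proof. by apply: contraNneq => ->. Qed.

Lemma ImcV z : Im z^-1 = - (Im z / sqnormc z).
Proof. by case: z. Qed.

Lemma ImcV_lt0 z : 0 < Im z -> Im z^-1 < 0.
Proof.
move=> z0; have zn0 : z != 0 by rewrite Imc_neq0 ?gt_eqF.
by rewrite ImcV oppr_lt0 divr_gt0 ?sqnormc_gt0.
Qed.

Lemma horner_conj (p : {poly R}) z :
  (map_poly toC p).[z^*%C] = ((map_poly toC p).[z])^*%C.
Proof.
rewrite -[in RHS]horner_map -map_poly_comp; congr (_.[_]).
by apply: eq_map_poly => a /=; rewrite oppr0.
Qed.

(* Gauss-Lucas: [F'/F] is the sum of the [1 / (z - y)] over the roots [y] of
   [F], all of which make [c * (z - y)] have positive imaginary part. *)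
Lemma gauss_lucas (c : C) (d : R) (F : {poly C}) :
  (forall z, d < Im (c * z) -> F.[z] != 0) -> (1 < size F)%N ->
  forall z, d < Im (c * z) -> F^`().[z] != 0.
Proof.
move=> Fn0 sF z dz.
have [s Fs] := closed_field_poly_normal F.
have lF : lead_coef F != 0 by rewrite lead_coef_eq0 -size_poly_gt0 ltnW.
have rs y : y \in s -> Im (c * y) <= d.
  move=> ys; rewrite leNgt; apply/negP => /Fn0; rewrite Fs hornerZ horner_prod.
  by rewrite (big_rem y) //= hornerXsubC subrr mul0r mulr0 eqxx.
have zs y : y \in s -> 0 < Im (c * (z - y)).
  by move=> /rs h; rewrite mulrBr ImcD ImcN subr_gt0 (le_lt_trans h).
have zn y : y \in s -> z - y != 0.
  move=> /zs h; have /Imc_neq0: Im (c * (z - y)) != 0 by rewrite gt_eqF.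
  by apply: contraNneq => ->; rewrite mulr0.
have s1 : (0 < size s)%N.
  by move: sF; rewrite Fs size_scale // size_prod_XsubC ltnS.
(* The logarithmic derivative in product form. The induction runs over lists contained in [s], where
   [z - y] is known to be nonzero. *)
have dE (t : seq C) : {subset t <= s} ->
    (\prod_(y <- t) ('X - y%:P))^`().[z] =
    (\prod_(y <- t) ('X - y%:P)).[z] * \sum_(y <- t) (z - y)^-1.
  elim: t => [|y t IH] sub; first by rewrite !big_nil derivC horner0 mulr0.
  have ys := sub y (mem_head _ _).
  rewrite !big_cons derivM derivXsubC !hornerE IH; last first.
    by move=> u ut; apply: sub; rewrite inE ut orbT.
  by field; rewrite zn.
rewrite Fs derivZ hornerZ mulf_neq0 // dE //.
rewrite mulf_neq0 //.
  by have := Fn0 z dz; rewrite {1}Fs hornerZ mulf_eq0 negb_or => /andP[].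
have cn0 : c != 0.
  case: s s1 zs {Fs rs zn dE} => // y s _ /(_ y (mem_head _ _)).
  by apply: contraTneq => ->; rewrite mul0r ltxx.
(* Dividing the sum by [c] turns its terms into [1 / (c * (z - y))], whose imaginary parts are all
   negative. *)
rewrite -(mulIr_eq0 _ (mulIf (invr_neq0 cn0))) Imc_neq0 // mulr_suml Imc_sum.
rewrite lt_eqF // big_seq.
have -> : \sum_(i <- s | i \in s) Im ((z - i)^-1 / c) =
          - \sum_(i <- s | i \in s) - Im ((c * (z - i))^-1).
  by rewrite sumrN opprK; apply: eq_bigr => i _; rewrite invfM mulrC.
case: s s1 zs {Fs rs zn dE} => // y s _ zs.
rewrite -big_seq big_cons oppr_lt0 big_seq ltr_pwDl //.
  by rewrite oppr_gt0 ImcV_lt0 // zs ?mem_head.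
apply: sumr_ge0 => u us.
by rewrite oppr_ge0 ltW // ImcV_lt0 // zs // inE us orbT.
Qed.

(** Iterates [gauss_lucas]; the [m]-th derivative is a factorial multiple of the normalized one, so
    its nonvanishing suffices. *)
Lemma gauss_lucas_nderivn (c : C) (d : R) (F : {poly C}) m :
  (forall z, d < Im (c * z) -> F.[z] != 0) -> (m < size F)%N ->
  forall z, d < Im (c * z) -> (F^`N(m)).[z] != 0.
Proof.
move=> Fn0 sF z dz.
suff : (F^`(m)).[z] != 0.
  by apply: contraNneq; rewrite nderivn_def hornerMn => ->; rewrite mul0rn.
elim: m F Fn0 sF => [|m IH] F Fn0 sF; first by rewrite derivn0 Fn0.
rewrite derivSn; apply: IH; first by apply: gauss_lucas => //; apply: leq_trans sF.
(* If the derivative were too short, its coefficient coming from the leading term of [F] would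
   vanish, impossible in characteristic zero. *)
rewrite ltnNge; apply/negP => sF'.
have : F^`()`_((size F).-2) = 0.
  by rewrite nth_default // (leq_trans sF') //; case: (size F) sF => [|[]].
have szE : (size F).-2.+1 = (size F).-1 by case: (size F) sF => [|[]].
rewrite coef_deriv szE => /eqP; rewrite mulrn_eq0 -lead_coefE lead_coef_eq0.
by case: (eqVneq F 0) sF => [->|_]; rewrite ?size_poly0 // -szE.
Qed.

(** The coefficients are real, so conjugation carries a root in the lower half-plane to one in the
    upper; all complex roots are therefore real. *)
Lemma split_of_upper_halfplane (P : {poly R}) :
  (forall z, 0 < Im z -> (map_poly toC P).[z] != 0) ->
  {s : seq R | sorted <=%O s & P = lead_coef P *: \prod_(a <- s) ('X - a%:P)}.
Proof.
move=> Pn0; have [s Ps] := closed_field_poly_normal (map_poly toC P).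
exists (sort <=%O [seq Re y | y <- s]); first exact/sort_sorted/le_total.
have [->|P0] := eqVneq P 0; first by rewrite lead_coef0 scale0r.
have lP : lead_coef (map_poly toC P) = toC (lead_coef P) by rewrite lead_coef_map.
have rs y : y \in s -> toC (Re y) = y.
  move=> ys.
  have Py : (map_poly toC P).[y] = 0.
    rewrite Ps hornerZ horner_prod (big_rem y) //= hornerXsubC subrr mul0r.
    by rewrite mulr0.
  have : Im y = 0; last by case: {ys Py} y => a b /= ->.
  apply/eqP; rewrite eq_le !leNgt; apply/andP; split; apply/negP => h.
    by have := Pn0 _ h; rewrite Py eqxx.
  have : 0 < Im y^*%C by rewrite ImcJ oppr_gt0.
  by move=> /Pn0; rewrite horner_conj Py rmorph0 eqxx.
apply: (@map_poly_inj _ _ toC); rewrite map_polyZ {1}Ps lP; congr (_ *: _).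
rewrite (perm_big [seq Re y | y <- s]) ?perm_sort //=.
rewrite big_map rmorph_prod /= big_seq [RHS]big_seq; apply: eq_bigr => y ys.
by rewrite rmorphB /= map_polyX map_polyC /= rs.
Qed.

End HalfPlane.

(** * Interlacing *)

Section Interlacing.
Variable R : rcfType.
Local Notation C := R[i].
Local Notation toC := (real_complex R).
Local Notation "p ^C" := (map_poly toC p) (format "p ^C").
Implicit Types (z w : C) (a b : R) (A B : seq R) (p q : {poly R}).

(** On real arguments the imaginary part of [F] is itself a real polynomial [h], and continuity of
    [h] carries the sign to 0. *)
Lemma Im_horner0_ge0 (F : {poly C}) :
  (forall e : R, 0 < e -> 0 <= Im F.[toC e]) -> 0 <= Im F.[0].
Proof.
move=> Fge0; pose h := \poly_(i < size F) Im F`_i.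
have hE e : h.[e] = Im F.[toC e].
  rewrite horner_poly horner_coef Imc_sum; apply: eq_bigr => i _.
  by rewrite -rmorphXn Imc_Mreal.
have -> : F.[0] = F.[toC 0] by rewrite rmorph0.
rewrite -hE leNgt; apply/negP => h0.
have [|d d0 hd] := @poly_cont _ 0 h (- h.[0]); first by rewrite oppr_gt0.
have d2 : 0 < d / 2 by rewrite divr_gt0.
have := hd (d / 2); rewrite subr0 gtr0_norm // => /(_ _)/wrap[].
  by rewrite ltr_pdivrMr // ltr_pMr // ltr1n.
have := Fge0 _ d2; rewrite -hE => h2.
by rewrite ltr_norml => /andP[_]; lra.
Qed.

(** For [1 < m] the chosen root [m.-root y] has nonnegative imaginary part; were it real, its power
    [y] would be real too. *)
Lemma upper_root_exists (m : nat) (y : C) :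
  (1 < m)%N -> Im y != 0 -> exists2 u, 0 < Im u & u ^+ m = y.
Proof.
move=> m1 y0; have um : (m.-root y) ^+ m = y by rewrite rootCK // ltnW.
exists (m.-root y) => //.
have : 0 <= Im (m.-root y) by rewrite -lecR complexIm Im_rootC_ge0.
rewrite le_eqVlt => /predU1P[u0|//]; move: y0; rewrite -um.
suff -> : m.-root y = toC (Re (m.-root y)) by rewrite -rmorphXn /= eqxx.
by apply/eqP; rewrite eq_complex -u0 !eqxx.
Qed.

(** This is [Im (p / q) >= 0] on the upper half-plane, written without division. *)
Definition halfplane_pair p q :=
  forall z, 0 < Im z -> 0 <= Im (p^C.[z] * (q^C.[z])^*%C).

(** At [z = b + e u] with small [e > 0], the pairing is to leading order [p(b) q(b)] times the
    conjugate of [(e u)^(m+1)]. For [m = 0], [u = i] gives the sign; for larger [m], the power of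
    [u] can equal both [i] and [-i], which would force [p(b) q(b) = 0]. *)
Lemma halfplane_pair_local p q b m : halfplane_pair p (('X - b%:P) ^+ m.+1 * q) ->
  p.[b] != 0 -> q.[b] != 0 -> m = 0 /\ p.[b] * q.[b] < 0.
Proof.
move=> hpq pb qb.
have hC (f : {poly R}) : f^C.[toC b] = toC f.[b] by rewrite horner_map.
have key (u : C) : 0 < Im u -> 0 <= p.[b] * q.[b] * Im ((u ^+ m.+1)^*%C).
  move=> u0.
  (* For real [e] the conjugate of [b + u e] is polynomial in [e]; [F] is the pairing along this ray
     with the factor [e^(m+1)] removed. *)
  pose F := (p^C \Po ((toC b)%:P + u *: 'X)) *
            (q^C \Po ((toC b)%:P + u^*%C *: 'X)) * ((u ^+ m.+1)^*%C)%:P.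
  have := @Im_horner0_ge0 F.
  have -> : F.[0] = toC (p.[b] * q.[b]) * (u ^+ m.+1)^*%C.
    by rewrite /F !hornerM !horner_comp !(hornerD, hornerZ, hornerX, hornerC)
      !mulr0 !addr0 !hC rmorphM.
  rewrite Imc_realM; apply => e e0.
  set z := toC b + u * toC e.
  have z0 : 0 < Im z by rewrite ImcD Imc_Mreal /= add0r mulr_gt0.
  have := hpq z z0; rewrite rmorphM rmorphXn /= map_polyXsubC hornerM rmorphM.
  rewrite /= horner_exp hornerXsubC -horner_conj.
  have -> : z - toC b = u * toC e by rewrite /z; ring.
  have -> : z^*%C = toC b + u^*%C * toC e 
    by rewrite /z; case: (u) => c d; apply/eqP; rewrite eq_complex /=;
      apply/andP; split; apply/eqP; ring.
  have -> : ((u * toC e) ^+ m.+1)^*%C = toC (e ^+ m.+1) * (u ^+ m.+1)^*%C.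
    rewrite -[in RHS](conjc_real (e ^+ m.+1)) exprMn -rmorphXn mulrC.
    exact: (rmorphM (@conjc R)).
  set x1 := p^C.[_]; set x2 := q^C.[_]; set x3 := conjc _.
  rewrite /F !hornerM !horner_comp !(hornerD, hornerZ, hornerX, hornerC) -/z -/x1 -/x2.
  have -> : x1 * (toC (e ^+ m.+1) * x3 * x2) = toC (e ^+ m.+1) * (x1 * x2 * x3).
    by ring.
  by rewrite Imc_realM pmulr_rge0 // exprn_gt0.
have pq0 : p.[b] * q.[b] != 0 by rewrite mulf_neq0.
case: m {hpq} key => [|m] key.
  split=> //; have := key 'i%C; rewrite /= ltr01 => /(_ isT).
  by rewrite mulrN1 oppr_ge0 le_eqVlt (negPf pq0).
have [||u u0 um] := @upper_root_exists m.+2 'i%C => //; first by rewrite oner_eq0.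
have [||v v0 vm] := @upper_root_exists m.+2 (- 'i%C) => //.
  by rewrite ImcN oppr_eq0 oner_eq0.
have := key u u0; have := key v v0; rewrite um vm /=.
rewrite opprK mulr1 mulrN1 oppr_ge0.
move=> h1 h2; suff : p.[b] * q.[b] = 0 by move=> h; rewrite h eqxx in pq0.
by apply/eqP; rewrite eq_le; apply/andP; split; move: h1 h2; rewrite ?mulr1.
Qed.

(** The common factor multiplies the pairing by the squared modulus of [z - b], positive because [b]
    is real. *)
Lemma halfplane_pair_cancel b p q :
  halfplane_pair (('X - b%:P) * p) (('X - b%:P) * q) -> halfplane_pair p q.
Proof.
move=> hpq z z0; have := hpq z z0.
rewrite [map_poly _ (_ * p)]rmorphM [map_poly _ (_ * q)]rmorphM /=.
rewrite map_polyXsubC !hornerM hornerXsubC.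
set u := z - _; set y := p^C.[z]; set t := q^C.[z].
have -> : u * y * (u * t)^*%C = toC (sqnormc u) * (y * t^*%C).
  by rewrite -mulz_conj [(u * t)^*%C](rmorphM (@conjc R)) mulrACA.
rewrite Imc_realM pmulr_rge0 // sqnormc_gt0 Imc_neq0 // ImcD ImcN /= oppr0 addr0.
by rewrite gt_eqF.
Qed.

(** Interlacing is expressed through these counts because they ignore order and change equally when
    a common root is removed. *)
Definition count_gt a A := count (fun x => a < x) A.

Lemma count_gt_le a b A : a <= b -> (count_gt b A <= count_gt a A)%N.
Proof. by move=> ab; apply: sub_count => x /=; apply: le_lt_trans. Qed.

Lemma count_gt_lb A i a : sorted <=%R A -> (i < size A)%N -> a < A`_i ->
  (size A - i <= count_gt a A)%N.
Proof.
move=> sA iA ai; rewrite -size_drop /count_gt -{2}(cat_take_drop i A) count_cat.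
rewrite [X in (_ <= _ + X)%N](_ : _ = size (drop i A)) ?leq_addl //.
apply/eqP; rewrite -all_count; apply/(all_nthP 0) => j; rewrite size_drop => ji.
rewrite nth_drop; apply: (lt_le_trans ai).
by apply: (le_sorted_leq_nth 0 sA); rewrite ?inE ?leq_addr -?ltn_subRL.
Qed.

Lemma count_gt_ub A i a : sorted <=%R A -> (i < size A)%N -> A`_i <= a ->
  (count_gt a A <= size A - i.+1)%N.
Proof.
move=> sA iA ai; rewrite -size_drop /count_gt -{1}(cat_take_drop i.+1 A) count_cat.
rewrite [X in (X + _ <= _)%N](_ : _ = 0%N) ?count_size //.
apply/eqP; rewrite eqn0Ngt -has_count -all_predC; apply/(all_nthP 0) => j.
rewrite size_takel // => ji; rewrite /= nth_take // -leNgt; apply: le_trans ai.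
by apply: (le_sorted_leq_nth 0 sA); rewrite ?inE // (leq_ltn_trans _ iA).
Qed.

Lemma sgr_prod_count_gt a A : a \notin A ->
  Num.sg (\prod_(x <- A) ('X - x%:P)).[a] = (-1) ^+ count_gt a A.
Proof.
elim: A => [|x A IH]; first by rewrite big_nil hornerC sgr1.
rewrite inE negb_or => /andP[ax /IH]; rewrite big_cons hornerM sgrM => ->.
rewrite hornerXsubC /count_gt /= exprD; congr (_ * _).
have [h|h|h] := ltgtP a x; last by rewrite h eqxx in ax.
  by rewrite ltr0_sg ?subr_lt0.
by rewrite gtr0_sg ?subr_gt0.
Qed.

(** The alternating parity forces the nonincreasing [D] to drop at every step. Oddness gives
    [D (k - 1) >= 1], and parity improves [D 0 <= k + 1] to [D 0 <= k], leaving only drops of one.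
    Here [D j] will count the roots in [A] above the [j]-th root in [B]. *)
Lemma alternating_parity (D : nat -> nat) k :
  (forall j, (j.+1 < k)%N -> (D j.+1 <= D j)%N) ->
  (forall j, (j < k)%N -> odd (D j) = odd (k - j)) ->
  (D 0%N <= k.+1)%N -> forall j, (j < k)%N -> D j = (k - j)%N.
Proof.
move=> mD oD D0.
have lb i : (i < k)%N -> (i < D (k - i.+1))%N.
  elim: i => [|i IH] ik; first by have := oD (k - 1)%N; lia.
  have := IH (ltnW ik); have := mD (k - i.+2)%N; have := oD (k - i.+2)%N.
  by have -> : (k - i.+2).+1 = (k - i.+1)%N; lia.
have ub j : (j < k)%N -> (D j <= k - j)%N.
  elim: j => [|j IH] jk; first by have := oD 0%N; lia.
  by have := IH (ltnW jk); have := mD j; have := oD j.+1; lia.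
move=> j jk; apply/eqP; rewrite eqn_leq ub //=.
by have := lb (k - j.+1)%N; have -> : (k - (k - j.+1).+1)%N = j; lia.
Qed.

(** At each [b] in [B], [halfplane_pair_local] gives simplicity and opposite signs, that is, a
    parity relation between the counts; [alternating_parity] then determines how many roots in [A]
    exceed [b]. *)
Lemma count_gt_interlace_coprime A B : size A = (size B).+1 ->
  halfplane_pair (\prod_(a <- A) ('X - a%:P)) (\prod_(b <- B) ('X - b%:P)) ->
  {in B, forall b, b \notin A} ->
  forall a, (count_gt a B <= count_gt a A <= (count_gt a B).+1)%N.
Proof.
move=> sAB hAB BA a.
have rootB b : b \in B -> count_mem b B = 1%N /\
    odd (count_gt b A + count_gt b B).
  (* [B'] drops every copy of [b], isolating the full power of ['X - b%:P]; the exponent is written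
     as a successor to fit the local lemma. *)
  move=> bB; pose B' := [seq x <- B | x != b].
  have bB' : b \notin B' by rewrite mem_filter eqxx.
  have : \prod_(x <- B) ('X - x%:P) =
      ('X - b%:P) ^+ (count_mem b B).-1.+1 * \prod_(x <- B') ('X - x%:P).
    rewrite prednK -?has_count ?has_pred1 // (bigID (pred1 b)) /= big_filter.
    congr (_ * _).
    by rewrite (eq_bigr (fun=> 'X - b%:P)) ?big_const_seq ?iter_mulr_1 // => i /eqP->.
  have sA := sgr_prod_count_gt (BA b bB); have sB := sgr_prod_count_gt bB'.
  move=> BE; move: hAB; rewrite BE => /halfplane_pair_local[].
  - by rewrite -sgr_eq0 sA signr_eq0.
  - by rewrite -sgr_eq0 sB signr_eq0.
  move=> m1 sgn; split.
    by move: m1 bB; rewrite -has_pred1 has_count; case: count => [|[]].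
  have -> : count_gt b B = count_gt b B'.
    rewrite /count_gt count_filter; apply: eq_count => x /=.
    by rewrite lt_neqAle; case: eqVneq => [->|]; rewrite ?ltxx ?andbT.
  move: sgn; rewrite -sgr_cp0 sgrM sA sB -exprD -signr_odd; case: odd => //.
  by rewrite expr0 -subr_eq0 opprK paddr_eq0 ?ler01 // oner_eq0.
have uB : uniq B.
  apply: count_mem_uniq => b; case: (boolP (b \in B)) => [/rootB[]//|].
  by move/count_memPn.
pose S := sort <=%R B; pose k := size B.
have sS : sorted <=%R S by apply/sort_sorted/le_total.
have kS : size S = k by rewrite size_sort.
have cS x : count_gt x B = count_gt x S.
  by apply/permP; rewrite perm_sym perm_sort.
have ltS : sorted <%R S by rewrite lt_sorted_uniq_le sort_uniq uB.
have inS j : (j < k)%N -> S`_j \in B.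
  by move=> jk; rewrite -(mem_sort <=%R) mem_nth ?kS.
have cSj j : (j < k)%N -> count_gt S`_j S = (k - j.+1)%N.
  move=> jk; apply/eqP; rewrite eqn_leq -{1}kS count_gt_ub ?kS //=.
  have [jk'|] := ltnP j.+1 k; last by rewrite -subn_eq0 => /eqP->.
  by rewrite -{1}kS count_gt_lb ?kS // (lt_sorted_ltn_nth 0 ltS) ?inE ?kS.
have DA j : (j < k)%N -> count_gt S`_j A = (k - j)%N.
  apply: (alternating_parity (D := fun j => count_gt S`_j A)).
  - move=> i ik; apply/count_gt_le/(le_sorted_leq_nth 0 sS) => //.
      by rewrite inE kS ltnW.
    by rewrite inE kS.
  - by move=> i ik; have [_] := rootB _ (inS _ ik); rewrite cS cSj //; lia.
  - by rewrite -/k -sAB count_size.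
(* Counting indices from 0, the entries of [S] next to [a] are those of index [k - c - 1], at most
   [a], and [k - c], above [a]. Monotonicity squeezes the count of [A] at [a] between its values
   there; [c = 0] and [c = k] are the end cases. *)
rewrite cS; set c := count_gt a S.
have ck : (c <= k)%N by rewrite -kS count_size.
apply/andP; split.
  case: (posnP c) => [->//|c0].
  have jk : (k - c < k)%N by lia.
  rewrite (leq_trans _ (@count_gt_le a S`_(k - c) _ _)) ?DA //; first lia.
  rewrite leNgt; apply/negP => /ltW h.
  by have := @count_gt_ub S (k - c) a sS; rewrite kS -/c => /(_ jk h); lia.
have [ck0|ck'] := eqVneq c k; first by rewrite ck0 /k -sAB count_size.
have jk : (k - c.+1 < k)%N by lia.
rewrite (leq_trans (@count_gt_le S`_(k - c.+1) a _ _)) ?DA //; last lia.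
rewrite leNgt; apply/negP => h.
by have := @count_gt_lb S (k - c.+1) a sS; rewrite kS -/c => /(_ jk h); lia.
Qed.

(** Induction on the size of [B]: a common root contributes equally to both counts and cancels from
    the pairing, until the coprime case is reached. *)
Lemma count_gt_interlace A B : size A = (size B).+1 ->
  halfplane_pair (\prod_(a <- A) ('X - a%:P)) (\prod_(b <- B) ('X - b%:P)) ->
  forall a, (count_gt a B <= count_gt a A <= (count_gt a B).+1)%N.
Proof.
have [n] := ubnP (size B); elim: n A B => // n IH A B.
rewrite ltnS => Bn sAB hAB a.
have [|] := boolP (has (mem A) B); last first.
  by move/hasPn => h; apply: count_gt_interlace_coprime.
case/hasP => b bB /= bA.
have pA := perm_to_rem bA; have pB := perm_to_rem bB.
have -> : count_gt a B = count_gt a (b :: rem b B) by apply/permP.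
have -> : count_gt a A = count_gt a (b :: rem b A) by apply/permP.
have B0 : (0 < size B)%N by case: (B) bB.
rewrite /count_gt /= -addnS !leq_add2l; apply: IH.
- by rewrite size_rem // (leq_trans _ Bn) // ltn_predL.
- by rewrite !size_rem // sAB prednK.
have remE S : b \in S -> ('X - b%:P) * \prod_(y <- rem b S) ('X - y%:P) =
    \prod_(y <- S) ('X - y%:P) by move=> bS; rewrite [RHS](big_rem b bS).
by apply: (@halfplane_pair_cancel b); rewrite !remE.
Qed.

(** Failure of the left inequality contradicts the count comparison at the [i]-th entry of [B];
    failure of the right one contradicts it at the entry of [A] of index [i + 1]. *)
Lemma interlace_nth A B : sorted <=%R A -> sorted <=%R B ->
  size A = (size B).+1 ->
  halfplane_pair (\prod_(a <- A) ('X - a%:P)) (\prod_(b <- B) ('X - b%:P)) ->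
  forall i, (i < size B)%N -> A`_i <= B`_i <= A`_i.+1.
Proof.
move=> sA sB sAB /(count_gt_interlace sAB) cAB i iB; apply/andP; split.
  rewrite leNgt; apply/negP => h; have /andP[_] := cAB B`_i.
  have := count_gt_lb sA _ h; have := count_gt_ub sB iB (lexx _).
  by rewrite sAB; lia.
rewrite leNgt; apply/negP => h; have /andP[+ _] := cAB A`_i.+1.
have iA : (i.+1 < size A)%N by rewrite sAB.
have := count_gt_ub sA iA (lexx _); have := count_gt_lb sB iB h.
by rewrite sAB; lia.
Qed.

End Interlacing.

(** * Rank-one updates of determinants *)

(** The matrix determinant lemma in adjugate form. Two block factorizations evaluate the determinant
    of the bordered matrix [K], the second one up to a factor [\det M] that is cancelled at the
    end. *)
Lemma det_add_rank1 (D : idomainType) n (M : 'M[D]_n) (u : 'cV_n) (v : 'rV_n) :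
  \det M != 0 -> \det (M + u *m v) = \det M + (v *m \adj M *m u) 0 0.
Proof.
move=> M0; apply: (mulIf M0).
pose K := block_mx M (- u) v (1%:M : 'M_1).
have KE1 : K = block_mx (M + u *m v) (- u) 0 1%:M *m block_mx 1%:M 0 v 1%:M.
  by rewrite mulmx_block !mulmx1 !mulmx0 !mul1mx mulNmx addrK !add0r.
have KE2 : K *m block_mx 1%:M (\adj M *m u) 0 (\det M)%:M =
           block_mx M 0 v (v *m \adj M *m u + (\det M)%:M).
  rewrite mulmx_block !mulmx1 !mulmx0 !addr0 mul1mx !mulmxA mul_mx_adj.
  by rewrite mul_scalar_mx mul_mx_scalar scalerN subrr.
have := congr1 determinant KE2.
rewrite det_mulmx det_ublock det_lblock det1 mul1r det_scalar1.
rewrite [X in _ = _ * \det X -> _]mx11_scalar det_scalar1 !mxE eqxx mulr1n addrC.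
rewrite KE1 det_mulmx det_ublock det_lblock !det1 !mulr1 => ->.
by rewrite mulrC.
Qed.

Lemma coef_sign (R : nzRingType) (p : {poly R}) m l :
  ((-1) ^+ m * p)`_l = (-1) ^+ m * p`_l.
Proof.
by elim: m p => [|m IH] p; rewrite ?expr0 ?mul1r // !exprSr -!mulrA !mulN1r IH coefN.
Qed.

(** * Newton transformations of [r + t] *)

Section Newton.
Variables (R : comNzRingType) (n : nat).
Implicit Types A : 'M[R]_n.

Lemma newtonT0 A : newtonT 0 A = (sigma 0 A)%:M.
Proof. by rewrite /newtonT big_ord1 mul1r expr0 scalemx1. Qed.

Lemma newtonTS A j :
  newtonT j.+1 A = (sigma j.+1 A)%:M - A *m newtonT j A.
Proof.
rewrite /newtonT big_ord_recl /= expr0 mul1r subn0 expr0 scalemx1; congr (_ + _).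
rewrite mulmx_sumr -sumrN; apply: eq_bigr => i _.
by rewrite -scalemxAr /bump /= add1n subSS exprS mulN1r mulNr scaleNr [A ^+ _.+1]exprS.
Qed.

Let B A l : 'M[R]_n := map_mx (coefp l) (\adj (char_poly_mx A)).

(** Compares the coefficients of degree [l + 1] in [(X - A) adj (X - A) = char_poly A]. *)
Let BS A l : B A l = A *m B A l.+1 + ((char_poly A)`_l.+1)%:M.
Proof.
apply/matrixP => i j; have /matrixP/(_ i j) := mul_mx_adj (char_poly_mx A).
move/(congr1 (coefp l.+1)); rewrite {1}/char_poly_mx mulmxBl mul_scalar_mx.
rewrite !mxE /= coefB coefXM /= coefMn -/(char_poly A) => <-.
rewrite coef_sum addrCA [X in _ + X](_ : _ = 0) ?addr0 //.
rewrite -sumrB big1 // => u _.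
by rewrite !mxE coefCM subrr.
Qed.

(** Coefficients vanish beyond the sizes of all cofactors. Recursion [BS] carries this down to
    degree [n], since [char_poly A] has no coefficient above [n]. *)
Let B_ge A l : (n <= l)%N -> B A l = 0.
Proof.
move=> nl; pose N := (\max_i \max_j size (cofactor (char_poly_mx A) j i))%N.
have H d : forall l, (n <= l)%N -> (N <= l + d)%N -> B A l = 0.
  elim: d => [|d IH] m nm; rewrite ?addn0 => Nm.
    apply/matrixP => i j; rewrite !mxE /= nth_default // (leq_trans _ Nm) //.
    pose F i j := size (cofactor (char_poly_mx A) j i).
    rewrite -/(F i j); apply: (@leq_trans (\max_j F i j)%N).
      exact: (leq_bigmax (F := F i)).
    exact: (leq_bigmax (F := fun i => \max_j F i j)%N).
  rewrite BS IH ?(leqW nm) ?addSnnS // mulmx0 add0r nth_default ?size_char_poly //.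
  by rewrite raddf0.
exact: (H N l nl (leq_addl _ _)).
Qed.

(* The coefficients of [adj (X - A)], found by expanding
   [(X - A) adj (X - A) = char_poly A], obey the recursion of the [newtonT]. *)
Lemma coef_adj_char_poly_mx A j : (j < n)%N ->
  map_mx (coefp (n - j.+1)) (\adj (char_poly_mx A)) = (-1) ^+ j *: newtonT j A.
Proof.
rewrite -/(B A _); elim: j => [|j IH] jn.
  rewrite BS -subSn // subSS subn0 B_ge // mulmx0 add0r newtonT0 /sigma /= mul1r.
  by rewrite expr0 scale1r subn0.
rewrite BS -subSn // subSS IH 1?ltnW // newtonTS /sigma (ltnW jn) scalerBr addrC.
rewrite scale_scalar_mx signrMK.
by congr (_ + _); rewrite exprS mulN1r scaleNr opprK scalemxAr.
Qed.

End Newton.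

(** * Taylor expansion in a second variable *)

Section Shift.
Variables (R : comNzRingType) (n : nat).

(** With [t] the inner and [z] the outer variable, [f] substitutes [t - z] for [t], and
    [z - (r + t) = - (r + (t - z))]. *)
Lemma char_poly_mx_shiftX (r : 'M[R]_n) (f : {rmorphism {poly R} -> {poly {poly R}}}) :
  (forall a, f a%:P = a%:P%:P) -> f 'X = 'X%:P - 'X ->
  char_poly_mx (shiftX r) = - map_mx f (shiftX r).
Proof.
move=> fC fX; apply/matrixP => i j; rewrite /shiftX !mxE.
rewrite [f (_ + _)]rmorphD [f (_ *+ _)]rmorphMn /= fC fX polyCD polyCMn.
by rewrite mulrnBl; ring.
Qed.

(** Taylor's formula for [p (t - z)] in powers of [- z]. *)
Lemma coef_taylor (p : {poly R}) i (f : {rmorphism {poly R} -> {poly {poly R}}}) :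
  (forall a, f a%:P = a%:P%:P) -> f 'X = 'X%:P - 'X ->
  (f p)`_i = (-1) ^+ i * p^`N(i).
Proof.
move=> fC fX; pose cc := polyC \o polyC : R -> {poly {poly R}}.
have -> : f p = (map_poly cc p).['X%:P - 'X].
  elim/poly_ind: p => [|p c IH]; first by rewrite !rmorph0 horner0.
  by rewrite !rmorphD !rmorphM /= IH fC fX map_polyX map_polyC !hornerE.
(* The bound [N] also exceeds [i], so that the term of index [i] occurs in the sum even beyond the
   degree of [p]. *)
have [N iN sN] : exists2 N, (i < N)%N & (size (map_poly cc p) <= N)%N.
  by exists (maxn i.+1 (size (map_poly cc p))); rewrite ?leq_maxl ?leq_maxr.
rewrite (nderiv_taylor_wide _ sN); last exact: mulrC.
rewrite coef_sum (bigD1 (Ordinal iN)) //= big1 ?addr0; last first.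
  move=> j; rewrite -val_eqE /= => ji.
  rewrite nderivn_map map_poly_comp horner_map /= coefCM.
  by rewrite exprNn coef_sign coefXn eq_sym (negPf ji) !mulr0.
rewrite nderivn_map map_poly_comp horner_map /= coefCM -/(_ \Po _) comp_polyXr.
by rewrite [(- 'X) ^+ _]exprNn coef_sign coefXn eqxx mulr1 mulrC.
Qed.

Definition quad_adj (r : 'M[R]_n) (x : 'rV[R]_n) : {poly R} :=
  (map_mx polyC x *m \adj (shiftX r) *m (map_mx polyC x)^T) 0 0.

Let taylor_shift_subproof :
  commr_rmorph (polyC \o polyC : {rmorphism R -> {poly {poly R}}}) ('X%:P - 'X).
Proof. by move=> c; apply: mulrC. Qed.

Let f : {rmorphism {poly R} -> {poly {poly R}}} :=
  horner_morph taylor_shift_subproof.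
Let fC a : f a%:P = a%:P%:P. Proof. exact: horner_morphC. Qed.
Let fX : f 'X = 'X%:P - 'X. Proof. exact: horner_morphX. Qed.

(** The signs cancel: exponents [k] from Vieta, [n] from negating the matrix and [n - k] from Taylor
    add up to [2n]. *)
Lemma sigma_shiftX (r : 'M[R]_n) k : (k <= n)%N ->
  sigma k (shiftX r) = (\det (shiftX r))^`N(n - k).
Proof.
move=> kn; rewrite /sigma kn /char_poly (char_poly_mx_shiftX r fC fX).
rewrite -[- map_mx _ _]scaleN1r detZ det_map_mx coef_sign (coef_taylor _ _ fC fX) !mulrA -!exprD.
rewrite -signr_odd (_ : odd _ = false) ?mul1r //; lia.
Qed.

(** [coef_adj_char_poly_mx] makes the Newton transformation a coefficient in [z] of the adjugate,
    which [coef_taylor] turns into a derivative. *)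
Lemma newtonT_shiftX (r : 'M[R]_n) (x : 'rV[R]_n) k : (0 < k <= n)%N ->
  (map_mx polyC x *m newtonT k.-1 (shiftX r) *m (map_mx polyC x)^T) 0 0 =
  (quad_adj r x)^`N(n - k).
Proof.
case: k => // k /= kn.
have sgnK m : (-1) ^+ m * (-1) ^+ m = 1 :> {poly R}.
  by rewrite -exprD addnn -signr_odd odd_double.
have -> : newtonT k (shiftX r) = (-1) ^+ k *:
    map_mx (coefp (n - k.+1)) (\adj (char_poly_mx (shiftX r))).
  by rewrite coef_adj_char_poly_mx // scalerA sgnK scale1r.
rewrite (char_poly_mx_shiftX r fC fX) -[- map_mx _ _]scaleN1r adjZ -map_mx_adj.
have -> : (quad_adj r x)^`N(n - k.+1) =
    (-1) ^+ (n - k.+1) * (f (quad_adj r x))`_(n - k.+1).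
  by rewrite (coef_taylor _ _ fC fX) mulrA sgnK mul1r.
rewrite /quad_adj !mxE rmorph_sum /= coef_sum !mulr_sumr; apply: eq_bigr => i _.
rewrite !mxE rmorphM /= fC rmorph_sum /= coefMC mulrA; congr (_ * _).
rewrite coef_sum mulr_sumr; apply: eq_bigr => j _.
rewrite !mxE; set c := cofactor _ _ _; rewrite [in RHS]rmorphM /= fC coefCM /=.
rewrite coef_sign [in RHS]mulrCA; congr (_ * _).
rewrite mulrA -exprD; congr (_ * _); rewrite -signr_odd -[RHS]signr_odd.
by congr (_ ^+ _); congr nat_of_bool; lia.
Qed.

Lemma det_shiftX (r : 'M[R]_n) : \det (shiftX r) = char_poly (- r).
Proof.
by rewrite /char_poly /char_poly_mx /shiftX map_mxN opprK addrC.
Qed.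

End Shift.

(** * Perturbation, degree and roots of [det (t + r)] *)

(** [det_add_rank1] applies over [{poly D}] because [det (t + r)] is monic, hence nonzero. *)
Lemma det_shiftX_rank1 (D : idomainType) n (r : 'M[D]_n) (x : 'rV[D]_n) (w : D) :
  \det (shiftX (r + w *: (x^T *m x))) = \det (shiftX r) + w%:P * quad_adj r x.
Proof.
have -> : shiftX (r + w *: (x^T *m x)) =
    shiftX r + (w%:P *: (map_mx polyC x)^T) *m map_mx polyC x.
  rewrite /shiftX map_mxD map_mxZ map_mxM map_trmx -scalemxAl.
  by rewrite -!addrA; congr (_ + _); rewrite addrC.
rewrite det_add_rank1; first by rewrite -scalemxAr mxE.
by rewrite det_shiftX monic_neq0 // char_poly_monic.
Qed.

Lemma map_shiftX (D E : comNzRingType) (f : {rmorphism D -> E}) n (r : 'M[D]_n) :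
  map_mx (map_poly f) (shiftX r) = shiftX (map_mx f r).
Proof.
apply/matrixP => i j; rewrite !mxE rmorphD rmorphMn /=.
by rewrite map_polyC map_polyX.
Qed.

Lemma map_quad_adj (D E : comNzRingType) (f : {rmorphism D -> E}) n (r : 'M[D]_n)
    (x : 'rV[D]_n) :
  map_poly f (quad_adj r x) = quad_adj (map_mx f r) (map_mx f x).
Proof.
rewrite /quad_adj -(map_shiftX f) -map_mx_adj.
have -> : map_mx polyC (map_mx f x) = map_mx (map_poly f) (map_mx polyC x).
  by apply/matrixP => i j; rewrite !mxE /= map_polyC.
by rewrite [(map_mx (map_poly f) _)^T]map_trmx -!map_mxM [RHS]mxE.
Qed.

(** By the rank-one formula at [w = 1], this is a difference of two monic polynomials of degree
    [n]. *)
Lemma size_quad_adj (D : idomainType) n (r : 'M[D]_n) (x : 'rV[D]_n) :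
  (size (quad_adj r x) <= n)%N.
Proof.
have -> : quad_adj r x = \det (shiftX (r + 1 *: (x^T *m x))) - \det (shiftX r).
  by rewrite det_shiftX_rank1 mul1r addrC addKr.
have coef_n (s : 'M[D]_n) j : (n <= j)%N -> (\det (shiftX s))`_j = (j == n)%:R.
  rewrite det_shiftX leq_eqVlt => /predU1P[<-|nj].
    by have /monicP := char_poly_monic (- s); rewrite lead_coefE size_char_poly eqxx.
  by rewrite nth_default ?size_char_poly // gtn_eqF.
by apply/leq_sizeP => j nj; rewrite coefB !coef_n // subrr.
Qed.

Lemma det_shiftX_roots (D : comNzRingType) n (r : 'M[D]_n) (rr : 'I_n -> D) :
  char_poly r = \prod_(j < n) ('X - (rr j)%:P) ->
  \det (shiftX r) = \prod_(j < n) ('X + (rr j)%:P).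
Proof.
move=> heig; have := congr1 (comp_poly (- 'X)) heig.
rewrite /char_poly -det_map_mx rmorph_prod /=.
have -> : map_mx (comp_poly (- 'X)) (char_poly_mx r) = (- 1) *: shiftX r.
  apply/matrixP => i j; rewrite !mxE rmorphB rmorphMn /= comp_polyX comp_polyC.
  by rewrite mulN1r opprD mulNrn addrC.
rewrite detZ => /(congr1 (fun p => (-1) ^+ n * p)); rewrite signrMK => ->.
rewrite -{1}[n]card_ord -prodrN; apply: eq_bigr => j _.
by rewrite comp_polyB comp_polyX comp_polyC opprB opprK addrC.
Qed.

(** * The pencil [q + w g] *)

Section Main.
Variable R : rcfType.
Local Notation C := R[i].
Local Notation toC := (real_complex R).
Local Notation "p ^C" := (map_poly toC p) (format "p ^C").
Variables (n : nat) (r : 'M[R]_n) (hsym : r^T = r) (x : 'rV[R]_n).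
Let rC := map_mx toC r.
Let xC := map_mx toC x.

(* A null row vector [v] would give [v s v^* = 0], whose imaginary part is
   [Im z |v|^2 + Im w |v x^T|^2]. *)
Lemma det_rank1_neq0 (z w : C) : 0 < Im z -> 0 <= Im w ->
  \det (z%:M + rC + w *: (xC^T *m xC)) != 0.
Proof.
move=> z0 w0; apply/det0P => -[v vn0].
pose vb := map_mx (@conjc R) v.
move/(congr1 (fun s => (s *m vb^T) 0 0)).
rewrite mul0mx [RHS]mxE !mulmxDr !mulmxDl mul_mx_scalar -scalemxAl.
rewrite -scalemxAr -scalemxAl.
have -> : v *m (xC^T *m xC) *m vb^T = (v *m xC^T) *m (xC *m vb^T) by rewrite !mulmxA.
have E1 : (v *m vb^T) 0 0 = toC (\sum_i sqnormc (v 0 i)).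
  by rewrite mxE rmorph_sum; apply: eq_bigr => i _; rewrite !mxE mulz_conj.
(* Since [r] is real symmetric, conjugating the form amounts to exchanging its two sums, so its
   value is real. *)
have E2 : Im ((v *m rC *m vb^T) 0 0) = 0.
  have -> : (v *m rC *m vb^T) 0 0 =
      \sum_i \sum_j v 0 j * toC (r j i) * (v 0 i)^*%C.
    rewrite mxE; apply: eq_bigr => i _; rewrite !mxE mulr_suml.
    by apply: eq_bigr => j _; rewrite !mxE.
  set S := \sum_i _; suff h : S^*%C = S.
    by have := congr1 (@complex.Im _) h; rewrite ImcJ; lra.
  rewrite [LHS](rmorph_sum (@conjc R)) [RHS]exchange_big; apply: eq_bigr => i _.
  rewrite [LHS](rmorph_sum (@conjc R)); apply: eq_bigr => j _.
  rewrite !(rmorphM (@conjc R)) /= -[LHS]/(_ * (toC _)^*%C * _) conjc_real.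
  rewrite conjcK -{1}hsym mxE.
  by rewrite mulrC mulrA mulrAC.
have E3 : ((v *m xC^T) *m (xC *m vb^T)) 0 0 = toC (sqnormc ((v *m xC^T) 0 0)).
  rewrite mxE big_ord1 -mulz_conj; congr (_ * _).
  rewrite !mxE [RHS](rmorph_sum (@conjc R)); apply: eq_bigr => i _.
  by rewrite !mxE [RHS](rmorphM (@conjc R)) [X in _ = _ * X]conjc_real mulrC.
have addE (A A' : 'M[C]_1) : (A + A') 0 0 = A 0 0 + A' 0 0 by rewrite mxE.
have scaleE (a : C) (A : 'M[C]_1) : (a *: A) 0 0 = a * A 0 0 by rewrite mxE.
rewrite !addE !scaleE E1 E3 => /(congr1 (@complex.Im _)).
rewrite !ImcD E2 !Imc_Mreal addr0 => /eqP.
have S0 : 0 <= \sum_i sqnormc (v 0 i).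
  by apply: sumr_ge0 => i _; apply: sqnormc_ge0.
have T0 := mulr_ge0 w0 (sqnormc_ge0 ((v *m xC^T) 0 0)).
rewrite (paddr_eq0 (mulr_ge0 (ltW z0) S0) T0) mulf_eq0 gt_eqF //= => /andP[+ _].
rewrite psumr_eq0 => [/allP v0|i _]; last exact: sqnormc_ge0.
case/eqP: vn0; apply/rowP => i; rewrite mxE; apply/eqP.
by rewrite -sqnormc_eq0; apply: v0; rewrite mem_index_enum.
Qed.

Definition pencil (w : C) : {poly C} :=
  (\det (shiftX r))^C + w *: (quad_adj r x)^C.

Lemma pencilE w : pencil w = \det (shiftX (rC + w *: (xC^T *m xC))).
Proof.
rewrite det_shiftX_rank1 /pencil -det_map_mx map_shiftX map_quad_adj.
by rewrite mul_polyC.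
Qed.

Lemma size_pencil w : size (pencil w) = n.+1.
Proof. by rewrite pencilE det_shiftX size_char_poly. Qed.

Lemma pencil_neq0 (z w : C) : 0 < Im z -> 0 <= Im w -> (pencil w).[z] != 0.
Proof.
move=> z0 w0; rewrite pencilE -horner_evalE -det_map_mx.
rewrite [map_mx _ _](_ : _ = z%:M + rC + w *: (xC^T *m xC)) ?det_rank1_neq0 //.
apply/matrixP => i j; rewrite [LHS]mxE /= /horner_eval /shiftX !mxE.
by rewrite !hornerE hornerMn hornerX; ring.
Qed.

(** * Derivatives of the pencil: real roots, interlacing, bounds *)

Section Derived.
Variables (m : nat) (hm : (m < n)%N) (r00 : R).
Let Q := (\det (shiftX r))^`N(m).
Let G := (quad_adj r x)^`N(m).
Let P := (r00%:P + 'X) * Q - G.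

Lemma pencil_nderivn_neq0 (z w : C) : 0 < Im z -> 0 <= Im w ->
  Q^C.[z] + w * G^C.[z] != 0.
Proof.
move=> z0 w0.
have := @gauss_lucas_nderivn R 1 0 (pencil w) m.
rewrite size_pencil ltnS ltnW // => /(_ _ isT z).
rewrite mul1r nderivnD nderivnZ !nderivn_map hornerD hornerZ; apply => // u.
by rewrite mul1r => u0; apply: pencil_neq0.
Qed.

Lemma nderivn_det_neq0 (z : C) : 0 < Im z -> Q^C.[z] != 0.
Proof.
by move=> z0; have := @pencil_nderivn_neq0 z 0 z0 (lexx 0); rewrite mul0r addr0.
Qed.

(** The term [(r00 + z) Q] contributes [Im z] times the squared modulus of [Q], which is positive.
    If [G] times the conjugate of [Q] had positive imaginary part, [w = - Q / G] would have
    [Im w >= 0] and satisfy [Q + w G = 0], against [pencil_nderivn_neq0]. *)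
Lemma Im_nderivn_pencil_gt0 (z : C) : 0 < Im z -> 0 < Im (P^C.[z] * (Q^C.[z])^*%C).
Proof.
move=> z0; have Q0 := nderivn_det_neq0 z0.
rewrite /P rmorphB rmorphM rmorphD /= map_polyC map_polyX !hornerE.
set q := Q^C.[z]; set g := G^C.[z].
rewrite mulrBl -mulrA mulz_conj ImcD ImcN Imc_Mreal.
have -> : Im (toC r00 + z) = Im z by rewrite ImcD add0r.
rewrite subr_gt0 (@le_lt_trans _ _ 0) ?mulr_gt0 ?sqnormc_gt0 //.
rewrite leNgt; apply/negP => h.
have g0 : g != 0 by apply: contraTneq h => ->; rewrite mul0r ltxx.
have := @pencil_nderivn_neq0 z (- q / g) z0; rewrite -/q -/g divfK // subrr eqxx.
suff -> : 0 <= Im (- q / g) by move=> /(_ isT).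
have -> : - q / g = - ((g * q^*%C)^*%C) * toC (sqnormc g)^-1.
  have -> : (g * q^*%C)^*%C = g^*%C * q.
    by rewrite [LHS](rmorphM (@conjc R)); congr (_ * _); apply: conjcK.
  have -> : toC (sqnormc g)^-1 = (g * g^*%C)^-1 by rewrite mulz_conj fmorphV.
  by field; rewrite conjc_eq0 g0.
by rewrite Imc_Mreal ImcN ImcJ opprK mulr_ge0 ?invr_ge0 ?sqnormc_ge0 // ltW.
Qed.

Let k := (n - m)%N.

Lemma size_lead_nderivn_det : size Q = k.+1 /\ 0 < lead_coef Q.
Proof.
have Qk : Q`_k = 'C(n, m)%:R.
  rewrite /Q coef_nderivn /k subnKC ?(ltnW hm) // det_shiftX.
  by have /monicP := char_poly_monic (- r); rewrite lead_coefE size_char_poly => ->.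
have Qk0 : 0 < Q`_k by rewrite Qk ltr0n bin_gt0 ltnW.
have sQ : size Q = k.+1.
  apply/eqP; rewrite eqn_leq; apply/andP; split.
    apply/leq_sizeP => j kj; rewrite /Q /G coef_nderivn nth_default ?mul0rn //.
    by rewrite det_shiftX size_char_poly; move: kj; rewrite /k; lia.
  by rewrite ltnNge; apply/negP => h; move: Qk0; rewrite nth_default ?ltxx.
by rewrite lead_coefE sQ.
Qed.

(** [G] has degree below [k], too small to affect the leading term. *)
Lemma size_lead_nderivn_pencil : size P = k.+2 /\ lead_coef P = lead_coef Q.
Proof.
have [sQ lQ] := size_lead_nderivn_det.
have sG : (size G <= k)%N.
  apply/leq_sizeP => j kj; rewrite /Q /G coef_nderivn nth_default ?mul0rn //.
  by rewrite (leq_trans (size_quad_adj r x)) //; move: kj; rewrite /k; lia.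
have Q0 : Q != 0 by rewrite -lead_coef_eq0 gt_eqF.
have mX : r00%:P + 'X = 'X + r00%:P by rewrite addrC.
have sP : size ((r00%:P + 'X) * Q) = k.+2.
  by rewrite mX size_monicM ?monicXaddC // size_XaddC sQ.
have lt : (size (- G) < size ((r00%:P + 'X) * Q)%R)%N.
  by rewrite size_polyN sP ltnS (leq_trans sG).
rewrite /P size_polyDl // lead_coefDl // sP lead_coefM mX.
by rewrite (monicP (monicXaddC _)) mul1r.
Qed.

Lemma nderivn_roots : exists A B : seq R, [/\ sorted <=%R A, sorted <=%R B,
    P = lead_coef P *: \prod_(a <- A) ('X - a%:P),
    Q = lead_coef Q *: \prod_(b <- B) ('X - b%:P) &
    [/\ size A = k.+1, size B = k &
        forall i, (i < k)%N -> A`_i <= B`_i <= A`_i.+1]].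
Proof.
have [sP lPQ] := size_lead_nderivn_pencil; have [sQ lQ] := size_lead_nderivn_det.
have [|A sA PA] := @split_of_upper_halfplane R P.
  by move=> z /Im_nderivn_pencil_gt0; apply: contraTneq => ->; rewrite mul0r ltxx.
have [|B sB QB] := @split_of_upper_halfplane R Q; first exact: nderivn_det_neq0.
have zA : size A = k.+1.
  apply: succn_inj; rewrite -sP PA size_scale ?size_prod_XsubC //.
  by rewrite lPQ gt_eqF.
have zB : size B = k.
  by apply: succn_inj; rewrite -sQ QB size_scale ?size_prod_XsubC // gt_eqF.
exists A, B; split=> //; split=> // i ik.
apply: interlace_nth; rewrite ?zA ?zB // => z z0.
(* [P] and [Q] share the leading coefficient [l], so passing to the monic products only removes the
   positive factor [l ^+ 2]. *)
have := Im_nderivn_pencil_gt0 z0; rewrite PA QB lPQ !map_polyZ !hornerZ.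
set a := _.[z]; set b := _.[z]; set l := lead_coef Q.
have -> : toC l * a * (toC l * b)^*%C = toC (l ^+ 2) * (a * b^*%C).
  have -> : (toC l * b)^*%C = toC l * b^*%C.
    by rewrite -[in RHS](conjc_real l); apply: (rmorphM (@conjc R)).
  by rewrite mulrACA -rmorphM.
by rewrite Imc_realM pmulr_rgt0 ?exprn_gt0 //; apply: ltW.
Qed.

(** Gauss-Lucas with [c = s i], for which [Im (c z) = s Re z]: the half-plane beyond the largest
    [s * - rr j] is free of roots. Taking [s = 1] and [s = -1] gives both bounds. *)
Lemma nderivn_root_bound (rr : 'I_n -> R) (s b : R) :
  char_poly r = \prod_(j < n) ('X - (rr j)%:P) -> root Q b ->
  exists j, s * b <= s * - rr j.
Proof.
move=> heig Qb.
have n0 : (0 < n)%N by apply: leq_ltn_trans hm.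
pose j0 := [arg max_(j > Ordinal n0) (s * - rr j)]%O.
have j0P j : s * - rr j <= s * - rr j0.
  by rewrite /j0; case: arg_maxP => // i _; apply.
exists j0; rewrite leNgt; apply/negP => h.
have ImE (z : C) : Im (toC s * 'i%C * z) = s * Re z.
  by case: z => u v /=; ring.
have := @gauss_lucas_nderivn R (toC s * 'i%C) (s * - rr j0) (\det (shiftX r))^C m.
rewrite size_map_poly det_shiftX size_char_poly ltnS ltnW // -det_shiftX.
move=> /(_ _ isT (toC b)); rewrite ImE /= h => /(_ _ isT).
rewrite nderivn_map horner_map /= (rootP Qb) rmorph0 eqxx => H.
have : false; last by []; apply: H => z; rewrite ImE => hz.
rewrite (det_shiftX_roots heig) rmorph_prod horner_prod.
apply/prodf_neq0 => j _.
rewrite rmorphD /= map_polyX map_polyC hornerD hornerX hornerC.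
apply: contraTneq hz => zE; rewrite -leNgt.
suff -> : Re z = - rr j by [].
have := congr1 (@complex.Re _) zE; case: (z) => u v /= /eqP.
by rewrite addr_eq0 => /eqP.
Qed.

End Derived.
End Main.

Theorem theorem2p2 (R : rcfType) (n k : nat)
  (hk1 : (1 <= k)%N) (hkn : (k <= n)%N)
  (r : 'M[R]_n) (hsym : r^T = r)
  (rr : 'I_n -> R) (heig : char_poly r = \prod_(j < n) ('X - (rr j)%:P))
  (x : 'rV[R]_n) (r00 : R) :
  size (pk1 k r00 r x) = k.+2 /\
  exists (alpha : 'I_k.+1 -> R) (beta : 'I_k -> R),
    [/\ pk1 k r00 r x = lead_coef (pk1 k r00 r x) *:
                        \prod_(i < k.+1) ('X - (alpha i)%:P),
        sigma k (shiftX r) = lead_coef (sigma k (shiftX r)) *: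
                        \prod_(i < k) ('X - (beta i)%:P),
        (forall i : 'I_k, alpha (inord i) <= beta i <= alpha (inord i.+1)) &
        (forall i : 'I_k.+1, (1 <= i)%N -> (i.+2 <= k)%N ->
           (exists j : 'I_n, - rr j <= alpha i) /\
           (exists j : 'I_n, alpha i <= - rr j))].
Proof.
have hm : (n - k < n)%N by lia.
rewrite /pk1 newtonT_shiftX ?hk1 // sigma_shiftX //.
have [+ _] := size_lead_nderivn_pencil r x hm r00; rewrite subKn // => sP.
have [A [B [_ _ PA QB [zA zB AB]]]] := nderivn_roots hsym x hm r00.
rewrite subKn // in zA zB AB; split=> //.
exists (fun i => A`_i), (fun i => B`_i).
have prodE (S : seq R) l : size S = l ->
    \prod_(i < l) ('X - (S`_i)%:P) =
    \prod_(a <- S) ('X - a%:P).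
  by move=> <-; rewrite (big_nth 0) big_mkord.
split=> /=.
- by rewrite (prodE _ _ zA).
- by rewrite (prodE _ _ zB).
- by move=> i; have ik := ltn_ord i; rewrite !inordK ?AB // ltnW.
have bound s i : (i < k)%N -> exists j, s * B`_i <= s * - rr j.
  move=> ik; apply: (nderivn_root_bound hm _ heig).
  rewrite QB; apply/rootP; rewrite hornerZ horner_prod.
  by rewrite (big_rem B`_i) /= ?hornerXsubC ?subrr ?mul0r ?mulr0 // mem_nth ?zB.
(* Indices start at 0: the root of index [i + 1] in [A] lies between those of index [i] and [i + 1]
   in [B], and the bounds on the latter transfer. *)
move=> [[|i] ik] //= _ ik2; have ik3 : (i.+1 < k)%N by apply: ltnW.
have /andP[_ Bi] := AB i (ltnW ik3); have /andP[AB' _] := AB _ ik3.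
split.
  have [j hj] := bound (-1) i (ltnW ik3); exists j; apply: le_trans Bi.
  by move: hj; rewrite !mulN1r lerN2.
have [j hj] := bound 1 _ ik3; exists j; apply: le_trans AB' _.
by move: hj; rewrite !mul1r.
Qed.
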